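(* Let $D$ be a connected, reduced, checkerboard-colored link diagram with at least one crossing and with associated Tait graph $G$. Then the number of $\sigma$-adequate states of $D$ (i.e. the number of states $\sigma$ of $D$ such that $D$ is $\sigma$-adequate with respect to $\sigma$) is bounded below by two and bounded above by the number of spanning trees in $G$.
   Context: A link diagram $D\subseteq\mathbb{R}^2$ has a projection graph $\Gamma_D$, obtained by replacing crossings with 4-valent vertices; $D$ is connected if $\Gamma_D$ is connected, and the regions of $D$ are the complementary regions of $\Gamma_D$. $D$ is reduced if it has no nugatory crossing, i.e. no crossing that meets a region of $D$ more than once. $D$ is checkerboard-colored if each region is shaded black or white so that near each crossing two opposite regions are black and the other two opposite regions are white. States. At each crossing one may perform the A-resolution (the smoothing joining the two regions swept out when the over-strand is rotated counterclockwise toward the under-strand) or the B-resolution (the other smoothing). A state $\sigma$ of $D$ is a choice of A- or B-resolution at each crossing. Resolving all crossings according to $\sigma$ gives the state graph $H_\sigma$, consisting of disjoint state circles together with one state segment per crossing, recording the location and type of the resolution. $D$ is $\sigma$-adequate with respect to $\sigma$ if no state segment of $H_\sigma$ connects a state circle to itself; such a $\sigma$ is called a $\sigma$-adequate state of $D$. Tait graph. The Tait graph $G$ of a checkerboard-colored diagram $D$ is the plane multigraph with one vertex per black region and one edge per crossing, joining the vertices of the two black regions meeting at that crossing (a loop if the same black region meets the crossing twice). (Its edges also carry signs, which play no role in this statement.) Spanning trees are counted as edge subsets, so parallel edges are distinguished. *)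

(* Defs.v *)
From mathcomp Require Import all_boot all_order all_algebra.
Set Implicit Arguments. Unset Strict Implicit. Unset Printing Implicit Defensive.
Import GRing.Theory.
Local Open Scope ring_scope.

Record mgraph := MGraph {
  vertex : finType;
  edge : finType;
  ends : edge -> vertex * vertex  (* unordered: see [joins] *)
}.

Section MultiGraph.
Variable G : mgraph.
Implicit Types (e : edge G) (u v : vertex G) (T : {set edge G}).

Definition joins e u v := (ends e == (u, v)) || (ends e == (v, u)).

Definition is_loop e := (ends e).1 == (ends e).2.

Definition connected_by T :=
  [forall u, forall v, connect [rel x y | [exists e in T, joins e x y]] u v].

(* [:: (v_0, e_0); ...; (v_k, e_k)] where e_i joins v_i to v_(i+1) and e_k joins
   v_k to v_0; loops (k = 0) and pairs of parallel edges (k = 1) are cycles. *)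
Definition is_cycle (s : seq (vertex G * edge G)) :=
  [&& s != [::], uniq (unzip1 s), uniq (unzip2 s)
    & cycle (fun a b => joins a.2 a.1 b.1) s].

(* The bound on the length, which makes this a boolean, loses no cycle, since
   the vertices of a cycle are distinct: see [acyclicP]. *)
Definition acyclic T :=
  [forall n : 'I_#|vertex G|.+1,
    forall s : n.-tuple (vertex G * edge G),
      ~~ (is_cycle s && all [in T] (unzip2 s))].

Lemma acyclicP T :
  reflect (forall s, is_cycle s -> ~~ all [in T] (unzip2 s)) (acyclic T).
Proof.
apply: (iffP forallP) => [acT s cs | acT n].
  have sz_s : (size s < #|vertex G|.+1)%N.
    by rewrite ltnS -(size_map fst) -(card_uniqP _) ?max_card //; case/and4P: cs.
  have /forallP/(_ (in_tuple s)) := acT (Ordinal sz_s).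
  by rewrite /= cs.
by apply/forallP=> s; apply/negP=> /andP[/acT/negP].
Qed.

Definition spanning_tree T := connected_by T && acyclic T.

Definition spanning_trees := [set T | spanning_tree T].

End MultiGraph.

(* A link diagram is given by its planar diagram code, that is by the
   combinatorial map of its projection graph: the half-edges at a crossing c are
   (c, 0), (c, 1), (c, 2), (c, 3) in counterclockwise order, (c, 0) and (c, 2)
   lying on the under-strand and (c, 1) and (c, 3) on the over-strand, and [arc]
   sends a half-edge to the other half of its edge.  Components without
   crossings are not represented; a connected diagram that has a crossing has
   none.  Which region is the unbounded one is not recorded. *)
Record pd_code := PDCode {
  crossing : finType;
  arc : crossing * 'I_4 -> crossing * 'I_4;
  arcK : involutive arc;
  arc_neq : forall x, arc x != x
}.

Definition resolution : finType := bool.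
Definition resA : resolution := true.
Definition resB : resolution := false.

Section PDCode.
Variable P : pd_code.

Definition half_edge : finType := (crossing P * 'I_4)%type.
Implicit Types (x y : half_edge) (c d : crossing P).

Definition over x := odd x.2.

(* The next half-edge counterclockwise around the crossing of x. *)
Definition node x : half_edge := (x.1, x.2 + 1).

(* A half-edge x also names the corner between x and node x.  The corner that
   follows it along the boundary of its region is found by crossing over to the
   far end of the edge of node x: regions are the orbits of [face]. *)
Definition face x : half_edge := arc (node x).

Definition face_orbit x := [set y | fconnect face x y].

Definition region : finType :=
  {r : {set half_edge} | [exists x, r == face_orbit x]}.

Lemma region_of_subproof x : [exists y, face_orbit x == face_orbit y].
Proof. by apply/existsP; exists x. Qed.

Definition region_of x : region := exist _ (face_orbit x) (region_of_subproof x).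

Definition adjacent c d := [exists i, (arc (c, i)).1 == d].

Definition connected := forall c d, connect adjacent c d.

(* V - E + F = 2 on each connected component: every component of the
   projection graph is drawn on a sphere. *)
Definition planar :=
  (#|crossing P| + #|region|
   = fcard (@arc P) {: half_edge} + 2 * n_comp adjacent {: crossing P})%N.

Definition nugatory c := ~~ injectiveb (fun i : 'I_4 => region_of (c, i)).

Definition reduced := forall c, ~~ nugatory c.

Definition state : finType := {ffun crossing P -> resolution}.
Implicit Types sigma : state.

(* Whether the smoothing joins the corner x to the opposite corner.  Rotating
   the over-strand counterclockwise sweeps the corners between x and node x
   with x on the over-strand. *)
Definition merged sigma x :=
  if sigma x.1 == resA then over x else ~~ over x.

(* The corners that are not merged are cut off, by an arc of the smoothing that
   links the two half-edges that bound them. *)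
Definition linked sigma x y :=
  [|| y == arc x,
      (y == node x) && ~~ merged sigma x
    | (x == node y) && ~~ merged sigma y].

Definition circle_through sigma x := [set y | connect (linked sigma) x y].

Definition state_circle sigma : finType :=
  {C : {set half_edge} | [exists x, C == circle_through sigma x]}.

Lemma circle_of_subproof sigma x :
  [exists y, circle_through sigma x == circle_through sigma y].
Proof. by apply/existsP; exists x. Qed.

Definition circle_of sigma x : state_circle sigma :=
  exist _ (circle_through sigma x) (circle_of_subproof sigma x).

(* The state segment at c connects the two arcs of the smoothing of c.  For both
   resolutions one of them ends at (c, 0) and the other at (c, 2). *)
Definition state_graph sigma : mgraph :=
  @MGraph (state_circle sigma) (crossing P)
    (fun c => (circle_of sigma (c, 0), circle_of sigma (c, 2%:R))).

Definition adequate sigma :=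
  [forall c, ~~ @is_loop (state_graph sigma) c].

Definition adequate_states := [set sigma | adequate sigma].

Record coloring := Coloring {
  black : region -> bool;
  black_node : forall x, black (region_of (node x)) = ~~ black (region_of x)
}.

Variable K : coloring.

Definition black_region : finType := {r : region | black K r}.

(* A black corner at c; the other one is opposite to it. *)
Definition black_corner c : half_edge :=
  if black K (region_of (c, 0)) then (c, 0) else node (c, 0).

Lemma black_cornerP c : black K (region_of (black_corner c)).
Proof. by rewrite /black_corner; case: ifPn; rewrite // black_node. Qed.

Lemma black_corner_oppP c :
  black K (region_of (node (node (black_corner c)))).
Proof. by rewrite !black_node negbK black_cornerP. Qed.

Definition tait_graph : mgraph :=
  @MGraph black_region (crossing P)
    (fun c => (exist _ (region_of (black_corner c)) (black_cornerP c),
               exist _ (region_of (node (node (black_corner c))))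
                       (black_corner_oppP c))).

End PDCode.

Record diagram := Diagram {
  diagram_code :> pd_code;
  diagram_planar : planar diagram_code
}.

(* Main.v *)
From mathcomp Require Import all_boot all_order all_algebra.
From mathcomp Require Import zify.
Require Import Defs.
Set Implicit Arguments. Unset Strict Implicit. Unset Printing Implicit Defensive.

(** Attach to a state the set of edges of the Tait graph at whose crossings the
    smoothing joins the two black corners.  This is injective, and it sends adequate
    states to cyclic flats of the cycle matroid of the Tait graph, that is, to edge
    sets [T] such that no edge of [T] is a bridge of [T] and no edge outside [T] has
    its ends connected by [T].  The upper bound then follows from a fact about all
    matroids: there are at most as many cyclic flats as bases.

    No edge [e] of [T] is a bridge ([band_not_bridge]): following the state circle
    that leaves [e] along one side of its band, one returns to [e] through the black
    regions and bands of [T], and adequacy ensures that the band of [e] itself was not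
    used.  Exchanging black and white turns [T] into its complement, so an edge
    outside [T] is not a bridge of the complement in the dual graph.  By planar
    duality its ends are then not connected by [T] ([no_linked_in_dual]).  Duality is
    obtained over the field with two elements: the incidence matrices of the two
    checkerboard graphs are orthogonal, and Euler's formula says that their ranks add
    up to the number of crossings, so the cycles of one graph are the cuts of the
    other.

    For the matroid inequality ([card_cyclic_flats_le]), order the elements once and
    for all and attach to a cyclic flat [F] the greedy basis obtained by scanning [F]
    backwards and then its complement forwards.  If two cyclic flats had the same
    basis, the first element of their symmetric difference would give a contradiction
    ([flat_basis_eq_sub]): either it would be spanned by the rest of the basis, or it
    would be spanned by the flat that does not contain it.

    For the lower bound, cut off all the black corners, or all the white ones: the
    state circles bound the regions of one color, and in a reduced diagram two
    different such regions meet at each crossing. *)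

(** * Cyclic flats and bases of a matroid *)

(** The closure-operator presentation of a matroid, because for the cycle matroid
    of a multigraph closure is just connectedness of the two ends of an edge. *)
Record matroid (E : finType) := Matroid {
  cl :> {set E} -> {set E};
  sub_cl : forall A : {set E}, A \subset cl A;
  cl_min : forall A B : {set E}, A \subset cl B -> cl A \subset cl B;
  cl_exchange : forall (A : {set E}) e f,
    e \in cl (f |: A) -> e \notin cl A -> f \in cl (e |: A)
}.

Section Matroid.
Variables (E : finType) (M : matroid E).
Implicit Types (A B F : {set E}) (e f x : E).

Definition independent B := [forall e in B, e \notin M (B :\ e)].
Definition basis B := independent B && (M B == setT).

(** The second condition says that no element is a coloop of the restriction to
    [F], that is, that [F] is a union of circuits. *)
Definition cyclic_flat F :=
  (M F == F) && [forall e in F, e \in M (F :\ e)].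

Lemma cl_mono A B : A \subset B -> M A \subset M B.
Proof. by move=> sAB; apply: cl_min; apply: subset_trans sAB (sub_cl _ _). Qed.

(** Otherwise exchange would put [g] in the closure of [x] and [A :\ g]; since [x]
    is also spanned by [A'], which avoids [g], the rest of [B] would span [g]. *)
Lemma independent_capl B A A' g x : independent B -> A \subset B ->
  A' \subset B -> g \in A -> g \notin A' -> x \in M A -> x \in M A' ->
  x \in M (A :\ g).
Proof.
move=> /forall_inP indB sAB sA'B gA gA' xA xA'; apply: contraT => xAg.
have /negP[] := indB g (subsetP sAB g gA).
have gx : g \in M (x |: A :\ g) by apply: cl_exchange; rewrite ?setD1K.
apply: (subsetP (cl_min _)) gx; rewrite subUset sub1set; apply/andP; split.
  apply: (subsetP (cl_mono _)) xA'; apply/subsetP=> y yA'.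
  by rewrite !inE (subsetP sA'B) // andbT; apply: contraNneq gA' => <-.
by apply: subset_trans (sub_cl _ _); apply: setSD.
Qed.

(** This stands for the uniqueness of fundamental circuits: if two parts of [B] span
    [x], both contain the fundamental circuit of [x] (minus [x]), hence so does
    their intersection.  Elements outside [A'] are deleted from [A] one at a time. *)
Lemma independent_cl_cap B A A' x : independent B -> A \subset B ->
  A' \subset B -> x \in M A -> x \in M A' -> x \in M (A :&: A').
Proof.
move=> indB + sA'B + xA'.
elim: {A}_.+1 {-2}A (ltnSn #|A|) => // n IHn A leAn sAB xA.
have [sAA' | /subsetPn[g gA gA']] := boolP (A \subset A').
  by rewrite (setIidPl sAA').
have -> : A :&: A' = (A :\ g) :&: A'.
  apply/setP=> y; rewrite !inE; case: eqP => // ->.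
  by rewrite (negPf gA') andbF.
apply: IHn; first by move: leAn; rewrite (cardsD1 g) gA.
  by apply: subset_trans (subD1set _ _) sAB.
exact: independent_capl indB sAB sA'B gA gA' xA xA'.
Qed.

(** The greedy algorithm that scans the elements by increasing weight [w] and keeps
    those that their predecessors do not span. *)
Section Greedy.
Variable w : E -> nat.
Hypothesis w_inj : injective w.

Definition before n := [set e | w e < n].
Definition greedy := [set e | e \notin M (before (w e))].

Lemma greedy_spans_before n : before n \subset M (greedy :&: before n).
Proof.
elim: n => [|n IHn]; first by apply/subsetP=> e; rewrite inE.
have sMn : M (greedy :&: before n) \subset M (greedy :&: before n.+1).
  by apply/cl_mono/setIS/subsetP=> y; rewrite !inE; lia.
apply/subsetP=> e; rewrite inE ltnS leq_eqVlt => /predU1P[we | lt_en]; last first.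
  by apply: (subsetP sMn); apply: (subsetP IHn); rewrite inE.
have [eB | eB] := boolP (e \in greedy).
  by apply: (subsetP (sub_cl _ _)); rewrite !inE in eB *; rewrite eB we ltnSn.
apply: (subsetP sMn); apply: (subsetP (cl_min IHn)).
by move: eB; rewrite inE negbK we.
Qed.

(** An element [e] of [greedy] is not spanned by the others: add these in order of
    weight and let [g] be the first to make the closure contain [e].  If [g]
    precedes [e], then predecessors of [e] span [e]; otherwise, by exchange,
    predecessors of [g] span [g]. *)
Lemma greedy_basis : basis greedy.
Proof.
have indep e : e \in greedy -> forall n, e \notin M ((greedy :\ e) :&: before n).
  move=> eB; elim=> [|n IHn].
    apply: contraTN eB => e0; rewrite inE negbK.
    by apply: (subsetP (cl_mono _)) e0; apply/subsetP=> y; rewrite !inE andbF.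
  have [/exists_inP[g gB /eqP wg] | noB] :=
      boolP [exists g in greedy :\ e, w g == n]; last first.
    have -> : (greedy :\ e) :&: before n.+1 = (greedy :\ e) :&: before n.
      apply/setP=> y; rewrite [LHS]inE [RHS]inE.
      have [yB /=|//] := boolP (y \in greedy :\ e).
      rewrite !inE ltnS leq_eqVlt; case: eqP => // wy.
      by case/exists_inP: noB; exists y; rewrite ?wy.
    by [].
  have -> : (greedy :\ e) :&: before n.+1 = g |: (greedy :\ e) :&: before n.
    apply/setP=> y; rewrite [LHS]inE !in_setU1 [in RHS]inE.
    have [-> | ne_yg] := eqVneq y g; first by rewrite gB inE wg ltnSn.
    congr (_ && _); rewrite !inE ltnS leq_eqVlt.
    by case: eqP => // wy; case/eqP: ne_yg; apply: w_inj; rewrite wg.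
  move: gB; rewrite !inE => /andP[ne_ge gB].
  apply/negP=> eg; have [lt_ge | le_eg] := ltnP (w g) (w e).
    move: eB; rewrite inE => /negP[]; apply: (subsetP (cl_mono _)) eg.
    by apply/subsetP=> y; rewrite !inE => /predU1P[-> // |]; lia.
  case/negP: gB; apply: (subsetP (cl_mono _)) (cl_exchange eg IHn).
  apply/subsetP=> y; rewrite !inE wg => /predU1P[-> |]; last by lia.
  rewrite -wg ltn_neqAle le_eg andbT.
  by apply: contraNneq ne_ge => /w_inj->.
have [N ltN] : exists N, forall e, w e < N.
  by exists (\max_e w e).+1 => e; rewrite ltnS leq_bigmax.
have beforeN : before N = setT by apply/setP=> e; rewrite !inE ltN.
apply/andP; split; last first.
  by rewrite -subTset -{1}beforeN -[greedy]setIT -beforeN greedy_spans_before.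
by apply/forall_inP=> e /indep/(_ N); rewrite beforeN setIT.
Qed.

End Greedy.

Definition position e : nat := enum_rank e.

Lemma position_lt e : position e < #|E|. Proof. exact: ltn_ord. Qed.

Lemma position_inj : injective position.
Proof. by move=> e f /val_inj/enum_rank_inj. Qed.

(** Scanning [F] backwards first makes the kept part of [F] its lexicographically
    last basis; scanning the complement forwards afterwards makes the rest the first
    basis of the contraction of [F].  So if [F] is a cyclic flat, no element is
    internally active in the restriction to [F] or externally active in the
    contraction. *)
Definition flat_weight F e : nat :=
  if e \in F then #|E| - position e else #|E|.+1 + position e.

Lemma flat_weight_inj F : injective (flat_weight F).
Proof.
move=> e f; rewrite /flat_weight => eq_w.
have := position_lt e; have := position_lt f => lt_f lt_e.
by apply/position_inj; move: eq_w; do 2!case: ifP => _; lia.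
Qed.

Definition flat_basis F := greedy (flat_weight F).

(** The decisive step of injectivity, applied to the first element [x] at which two
    flats with the same basis could differ.  If [x] is in the basis, it lies on a
    circuit in [F]; the elements of [F] after [x] are spanned by kept elements
    scanned before [x], those before [x] are in [F'] and so spanned by kept elements
    of [F'], and the basis without [x] spans [x].  If [x] is not in the basis, its
    fundamental circuit lies in [F] and in what is scanned before [x] for [F'];
    the common part lies in [F'], which is closed and so contains [x]. *)
Lemma flat_basis_eq_sub F F' x :
    cyclic_flat F -> cyclic_flat F' -> flat_basis F = flat_basis F' ->
    (forall y, position y < position x -> (y \in F) = (y \in F')) ->
  x \in F -> x \in F'.
Proof.
move=> /andP[/eqP clF /forall_inP cycF] /andP[/eqP clF' _] eqB minx xF.
apply: contraT => xF'.
have /andP[indB _] : basis (flat_basis F) := greedy_basis (@flat_weight_inj F).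
(* [G] is the first stretch of its own scan, so the kept elements of [G] span it *)
have spanF (G : {set E}) : G \subset M (flat_basis G :&: G).
  have before_G : before (flat_weight G) #|E|.+1 = G.
    apply/setP=> y; rewrite inE /flat_weight; case: ifP => _; last by lia.
    by rewrite ltnS leq_subr.
  by rewrite -{1 3}before_G greedy_spans_before.
have [xB | xB] := boolP (x \in flat_basis F).
  case/negP: (forall_inP indB x xB).
  apply: (subsetP (cl_min _)) (cycF x xF); apply/subsetP=> y.
  rewrite !inE => /andP[ne_yx yF].
  have [lt_yx | le_xy] := ltnP (position y) (position x).
    have yF' : y \in F' by rewrite -minx.
    apply: (subsetP (cl_mono _)) (subsetP (spanF F') y yF').
    rewrite -eqB; apply/subsetP=> z; rewrite !inE => /andP[-> zF'].
    by rewrite andbT; apply: contraNneq xF' => <-.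
  have lt_xy : position x < position y.
    rewrite ltn_neqAle le_xy andbT.
    by apply: contraNneq ne_yx => /position_inj->.
  have := greedy_spans_before (flat_weight F) (flat_weight F x).
  move=> /subsetP/(_ y); rewrite inE {1 2}/flat_weight yF xF.
  have lt_y := position_lt y.
  have lt_y' : #|E| - position y < #|E| - position x by lia.
  move=> /(_ lt_y'); apply: (subsetP (cl_mono _)).
  apply/subsetP=> z; rewrite in_setI in_setD1 => /andP[-> ].
  by rewrite inE andbT => ltz; apply: contraTneq ltz => ->; rewrite ltnn.
case/negP: (xF'); rewrite -clF'.
have xBF := subsetP (spanF F) x xF.
have xBF' : x \in M (flat_basis F :&: before (flat_weight F') (flat_weight F' x)).
  rewrite {1}eqB; apply: (subsetP (cl_min (greedy_spans_before _ _))).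
  by move: xB; rewrite eqB inE negbK.
have := independent_cl_cap indB (subsetIl _ _) (subsetIl _ _) xBF xBF'.
apply: (subsetP (cl_mono _)); apply/subsetP=> y; rewrite !inE.
move=> /andP[/andP[_ yF] /andP[_]].
rewrite /flat_weight (negPf xF'); case: ifP => // yF' lt_yx.
by rewrite -yF' -minx //; lia.
Qed.

Lemma flat_basis_inj : {in cyclic_flat &, injective flat_basis}.
Proof.
move=> F F' cF cF' eqB; apply/setP=> x.
elim: {x}_.+1 {-2}x (ltnSn (position x)) => // n IHn x ltxn.
have minx y : position y < position x -> (y \in F) = (y \in F').
  by move=> ltyx; apply: IHn; lia.
apply/idP/idP; first exact: flat_basis_eq_sub.
by apply: flat_basis_eq_sub => // y /minx->.
Qed.

(** This is the counting shadow of the convolution formula for the Tutte polynomial: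
    the bases of a matroid are distributed over its cyclic flats, and none of the
    classes is empty. *)
Theorem card_cyclic_flats_le :
  #|[set F | cyclic_flat F]| <= #|[set B | basis B]|.
Proof.
rewrite -(card_in_imset (f := flat_basis)); last first.
  by move=> F F'; rewrite !inE; apply: flat_basis_inj.
apply/subset_leq_card/subsetP=> _ /imsetP[F _ ->].
by rewrite inE; apply/greedy_basis/flat_weight_inj.
Qed.

End Matroid.

(** * The cycle matroid of a multigraph *)

Section GraphicMatroid.
Variable G : mgraph.
Implicit Types (e f : edge G) (u v x y : vertex G) (A B : {set edge G}).

Definition step A := [rel x y | [exists e in A, joins e x y]].
Definition linked_in A := connect (step A).

Lemma joinsC e u v : joins e u v = joins e v u.
Proof. exact: orbC. Qed.

Lemma joins_ends e : joins e (ends e).1 (ends e).2.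
Proof. by rewrite /joins -surjective_pairing eqxx. Qed.

Lemma linked_inC A : symmetric (linked_in A).
Proof.
apply: sym_connect_sym => x y.
by apply/exists_inP/exists_inP=> -[e eA]; rewrite joinsC; exists e.
Qed.

Lemma linked_in_trans A : transitive (linked_in A).
Proof. exact: connect_trans. Qed.

Lemma linked_in1 A e u v : e \in A -> joins e u v -> linked_in A u v.
Proof. by move=> eA juv; apply/connect1/exists_inP; exists e. Qed.

Lemma linked_in_joins A e u v : joins e u v ->
  linked_in A u v = linked_in A (ends e).1 (ends e).2.
Proof. by case/orP=> /eqP-> //=; rewrite linked_inC. Qed.

Lemma linked_in_min A B : (forall e, e \in A -> linked_in B (ends e).1 (ends e).2) ->
  forall u v, linked_in A u v -> linked_in B u v.
Proof.
move=> sAB; apply: connect_sub => x y /exists_inP[e /sAB eB jxy].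
by rewrite -/(linked_in B x y) (linked_in_joins _ jxy).
Qed.

(** The part of a path between two passages through [e] can be dropped, so one
    passage is enough. *)
Lemma linked_inU1 A e u v : linked_in (e |: A) u v ->
  linked_in A u v \/
  exists p q, [/\ joins e p q, linked_in A u p & linked_in A q v].
Proof.
case/connectP=> s + ->; elim: s u => [|y s IHs] u /=.
  by left; apply: connect0.
case/andP=> /exists_inP[f + juy] /IHs; rewrite in_setU1.
case: eqVneq juy => [-> | _] juy /= => [_ | fA]; last first.
  have uy := linked_in1 fA juy.
  case=> [yv | [p [q [jpq yp qv]]]]; [left | right].
    exact: linked_in_trans uy yv.
  by exists p, q; split=> //; apply: linked_in_trans uy yp.
case=> [yv | [p [q [jpq yp qv]]]].
  by right; exists u, y; split=> //; apply: connect0.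
have [eq_q | eq_q] : q = u \/ q = y.
  by move: juy jpq; rewrite /joins => /orP[] /eqP-> /orP[] /eqP[-> ->]; auto.
  by left; rewrite -eq_q.
by right; exists u, y; rewrite -{2}eq_q; split=> //; apply: connect0.
Qed.

Definition graph_cl A := [set e | linked_in A (ends e).1 (ends e).2].

Lemma mem_graph_cl A e : (e \in graph_cl A) = linked_in A (ends e).1 (ends e).2.
Proof. by rewrite inE. Qed.

Lemma sub_graph_cl A : A \subset graph_cl A.
Proof.
by apply/subsetP=> e eA; rewrite mem_graph_cl (linked_in1 eA) ?joins_ends.
Qed.

Lemma graph_cl_min A B : A \subset graph_cl B -> graph_cl A \subset graph_cl B.
Proof.
move=> /subsetP sAB; apply/subsetP=> e; rewrite !mem_graph_cl.
by apply: linked_in_min => f /sAB; rewrite mem_graph_cl.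
Qed.

Lemma graph_cl_exchange A e f :
  e \in graph_cl (f |: A) -> e \notin graph_cl A -> f \in graph_cl (e |: A).
Proof.
rewrite !mem_graph_cl => /linked_inU1[-> // | [p [q [jpq ep qe]]]] _.
have sub x y : linked_in A x y -> linked_in (e |: A) x y.
  by apply: linked_in_min => g gA; rewrite -mem_graph_cl;
     apply: (subsetP (sub_graph_cl _)); rewrite in_setU1 gA orbT.
rewrite -(linked_in_joins _ jpq).
apply: linked_in_trans (_ : linked_in _ p (ends e).1) _.
  by rewrite linked_inC sub.
apply: (@linked_in_trans _ (ends e).2); last by rewrite linked_inC sub.
by apply: linked_in1 (joins_ends e); rewrite setU11.
Qed.

Definition graphic_matroid : matroid (edge G) :=
  Matroid sub_graph_cl graph_cl_min graph_cl_exchange.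

(** The arguments follow the encoding of cycles as lists of pairs of a vertex and
    the edge that leaves it: [a :: s] is a walk whose last edge arrives at [v0]. *)
Lemma linked_in_path A v0 a s : all [in A] (unzip2 (a :: s)) ->
   path (fun a b : vertex G * edge G => joins a.2 a.1 b.1) a s ->
   joins (last a s).2 (last a s).1 v0 -> linked_in A a.1 v0.
Proof.
elim: s a => [|b s IHs] a /=; first by rewrite andbT => aA _; apply: linked_in1.
move=> /andP[aA sA] /andP[jab pbs] jl.
exact: linked_in_trans (linked_in1 aA jab) (IHs b sA pbs jl).
Qed.

(** The first edge of a cycle is spanned by the others, so a cycle inside [B]
    would contradict independence. *)
Lemma basis_spanning_tree B : connected_by [set: edge G] ->
  basis graphic_matroid B -> spanning_tree B.
Proof.
move=> /forallP connG /andP[/forall_inP indB /eqP clB].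
apply/andP; split.
  apply/forallP=> u; apply/forallP=> v; have /forallP/(_ v) := connG u.
  by apply: linked_in_min => e _; rewrite -mem_graph_cl [graph_cl B]clB inE.
apply/acyclicP=> -[|[v0 e0] s] // /and4P[_ _ /= /andP[e0s _] cyc_s].
apply/negP=> /andP[e0B sB]; have /negP[] := indB e0 e0B.
rewrite [_ \in _]mem_graph_cl.
case: s => [|[v1 e1] s] in e0s sB cyc_s *.
  move: cyc_s; rewrite /= andbT => j0.
  by rewrite -(linked_in_joins _ j0); apply: connect0.
move: cyc_s; rewrite rcons_path => /andP[/= /andP[j0 p1] jl].
rewrite -(linked_in_joins _ j0) linked_inC.
apply: (linked_in_path (a := (v1, e1))) p1 jl.
apply/allP=> e es; rewrite !inE (allP sB) // andbT.
by apply: contraNneq e0s => <-.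
Qed.

End GraphicMatroid.

(** * Duality over the field with two elements *)

Section Duality.
Import GRing.Theory.
Local Open Scope ring_scope.

Lemma addrr_F2 (a : 'F_2) : a + a = 0.
Proof. exact/addrr_pchar2/pchar_Fp. Qed.

Lemma addr_eq0_F2 (a b : 'F_2) : a + b = 0 -> a = b.
Proof.
by move=> ab0; rewrite -[a]addr0 -(addrr_F2 b) addrA ab0 add0r.
Qed.

Section Incidence.
Variable G : mgraph.
Implicit Types (e : edge G) (v : vertex G) (A : {set edge G}).

(** Counted modulo 2, so that a loop is not incident to its vertex. *)
Definition incident v e : 'F_2 := (v == (ends e).1)%:R + (v == (ends e).2)%:R.

Definition incidence : 'M['F_2]_(#|vertex G|, #|edge G|) :=
  \matrix_(i, j) incident (enum_val i) (enum_val j).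

Lemma incident_joins e u v w : joins e u w ->
  incident v e = (v == u)%:R + (v == w)%:R.
Proof. by rewrite /incident => /orP[] /eqP-> //=; rewrite addrC. Qed.

Lemma mul_incidence (s : 'rV['F_2]_#|vertex G|) e :
  (s *m incidence) 0 (enum_rank e) =
  s 0 (enum_rank (ends e).1) + s 0 (enum_rank (ends e).2).
Proof.
rewrite mxE (reindex (@enum_rank _)) /=; last first.
  by exists enum_val => i _; rewrite ?enum_rankK ?enum_valK.
under eq_bigr => v _ do rewrite mxE !enum_rankK mulrDr.
rewrite big_split /=; congr (_ + _).
  rewrite (bigD1 (ends e).1) //= eqxx mulr1 big1 ?addr0 // => v /negPf->.
  by rewrite mulr0.
rewrite (bigD1 (ends e).2) //= eqxx mulr1 big1 ?addr0 // => v /negPf->.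
by rewrite mulr0.
Qed.

(** A row vector killed by the incidence matrix takes the same value at both ends of
    each edge, so on a connected graph it is constant: the left kernel has
    dimension at most one. *)
Lemma rank_incidence : connected_by [set: edge G] ->
  (#|vertex G| <= (\rank incidence).+1)%N.
Proof.
move=> connG; suff: (\rank (kermx incidence) <= 1)%N.
  by rewrite mxrank_ker; lia.
apply: leq_trans (rank_leq_row (const_mx 1 : 'rV['F_2]_#|vertex G|)).
apply/mxrankS/row_subP=> i; have /sub_kermxP := row_sub i (kermx incidence).
move: (row i _) => s s0.
have sE u v : s 0 (enum_rank u) = s 0 (enum_rank v).
  have /forallP/(_ v)/connectP[p + ->] := forallP connG u.
  elim: p u => //= x p IHp u /andP[/exists_inP[e _ jux] /IHp<-].
  have := mul_incidence s e; rewrite s0 mxE => /esym/addr_eq0_F2.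
  by case/orP: jux => /eqP->.
suff -> : s = s 0 i *: const_mx 1 by apply: scalemx_sub.
apply/rowP=> j; rewrite !mxE mulr1.
by rewrite -[j]enum_valK -[i]enum_valK.
Qed.

(** The sum of the edges of a path from [u] to [v], as a mod 2 chain [z]. *)
Lemma chain_of_linked A u v : linked_in A u v ->
  exists z : 'rV['F_2]_#|edge G|,
    (forall e, e \notin A -> z 0 (enum_rank e) = 0) /\
    (forall x, (z *m incidence^T) 0 (enum_rank x) = (x == u)%:R + (x == v)%:R).
Proof.
case/connectP=> p + ->; elim: p u => [|y p IHp] u /=.
  by exists 0; split=> [e _|x]; rewrite ?mul0mx mxE // addrr_F2.
case/andP=> /exists_inP[e eA juy] /IHp[z [z0 dz]].
exists (z + delta_mx 0 (enum_rank e)); split=> [f fA | x].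
  rewrite mxE z0 // mxE add0r /= (inj_eq enum_rank_inj).
  by case: eqP fA => // ->; rewrite eA.
rewrite mulmxDl mxE dz -rowE !mxE !enum_rankK (incident_joins _ juy).
by rewrite addrC addrA -(addrA (_ == u)%:R) addrr_F2 addr0.
Qed.

End Incidence.

(** An algebraic Jordan curve theorem, for two graphs on the same edges.
    Orthogonality puts the cut space of [H] inside the cycle space of [G], and the
    rank bounds together with Euler's formula make them equal.  A path in [A] joining
    the ends of [e] in [G] closes up with [e] to a cycle of [G], that is, a cut of
    [H] that contains [e] and otherwise only edges of [A]; a path in [B] does not
    cross this cut, so it cannot join the two ends of [e] in [H]. *)
Lemma no_linked_in_dual (G : mgraph) (W : finType) (ends' : edge G -> W * W) :
  let H := MGraph ends' in
  connected_by [set: edge G] -> connected_by [set: edge H] ->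
  incidence G *m (incidence H)^T = 0 ->
  (#|vertex G| + #|W| = #|edge G| + 2)%N ->
  forall (A B : {set edge G}) (e : edge G),
  e \notin A -> e \notin B -> [disjoint A & B] ->
  linked_in A (ends e).1 (ends e).2 ->
  @linked_in H B (ends' e).1 (ends' e).2 -> False.
Proof.
move=> H connG connH orthoGH euler A B e eA eB dAB /chain_of_linked[z [z0 dz]] lB.
pose c := z + delta_mx 0 (enum_rank e).
have c_cycle : c *m (incidence G)^T = 0.
  apply/rowP=> i; rewrite -[i]enum_valK mulmxDl mxE dz -rowE !mxE !enum_rankK.
  by rewrite (incident_joins _ (joins_ends e)) addrr_F2.
have cutE : (kermx (incidence G)^T <= incidence H)%MS.
  have sHG : (incidence H <= kermx (incidence G)^T)%MS.
    by apply/sub_kermxP; rewrite -[LHS]trmxK trmx_mul trmxK orthoGH trmx0.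
  rewrite -(geq_leqif (mxrank_leqif_sup sHG)) mxrank_ker mxrank_tr.
  rewrite leq_subLR.
  have := leq_add (rank_incidence connG) (rank_incidence connH).
  by rewrite [X in (X <= _)%N]euler addn2 addnS addSn !ltnS.
have /submxP[s cE] : (c <= incidence H)%MS.
  by apply: submx_trans cutE; apply/sub_kermxP.
have cut f : c 0 (enum_rank f) =
    s 0 (enum_rank (ends' f).1) + s 0 (enum_rank (ends' f).2).
  by rewrite cE; apply: (@mul_incidence H).
have sB u v : @linked_in H B u v -> s 0 (enum_rank u) = s 0 (enum_rank v).
  case/connectP=> p + ->; elim: p u => //= x p IHp u.
  case/andP=> /exists_inP[f fB jux] /IHp<-.
  have fA : f \notin A by apply: contraL fB => /(disjointFr dAB)->.
  have := cut f; rewrite !mxE z0 // add0r eqxx (inj_eq enum_rank_inj) /=.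
  case: eqP => [fe | _]; first by rewrite fe (negPf eB) in fB.
  by case/orP: jux => /eqP/= -> /esym/addr_eq0_F2.
have := cut e; rewrite (sB _ _ lB) addrr_F2 !mxE z0 // !eqxx add0r.
by move/eqP; rewrite oner_eq0.
Qed.

End Duality.

(** * Half-edges, regions and state circles *)

Section HalfEdges.
Import GRing.Theory.
Local Open Scope ring_scope.
Variable P : pd_code.
Implicit Types (x y : half_edge P) (c d : crossing P) (sigma : state P).

Definition prev_node x : half_edge P := (x.1, x.2 - 1).
Definition opposite x := node (node x).

Lemma prev_nodeK : cancel prev_node (@node P).
Proof. by case=> c i; rewrite /node /= subrK. Qed.

Lemma nodeK : cancel (@node P) prev_node.
Proof. by case=> c i; rewrite /prev_node /= addrK. Qed.

Lemma node4 x : node (node (node (node x))) = x.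
Proof.
case: x => c i; rewrite /node /= -!addrA.
suff -> : 1 + (1 + (1 + 1)) = 0 :> 'I_4 by rewrite addr0.
exact: val_inj.
Qed.

Lemma oppositeK : involutive opposite. Proof. exact: node4. Qed.

Lemma prev_nodeE x : prev_node x = opposite (node x).
Proof. by apply: (can_inj nodeK); rewrite prev_nodeK /opposite node4. Qed.

Lemma over_node x : over (node x) = ~~ over x.
Proof. by case: x => c [[|[|[|[|i]]]] lti]. Qed.

Lemma crossing_cases x : let h := (x.1, 0) : half_edge P in
  [\/ x = h, x = node h, x = opposite h | x = node (opposite h)].
Proof.
case: x => c [[|[|[|[|i]]]] lti] //=;
  [apply: Or41|apply: Or42|apply: Or43|apply: Or44];
  by congr pair; apply: val_inj.
Qed.

Lemma face_inj : injective (@face P).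
Proof. exact: inj_comp (can_inj (@arcK P)) (can_inj nodeK). Qed.

Lemma region_ofP x y : reflect (region_of x = region_of y) (fconnect (@face P) x y).
Proof.
apply: (iffP idP) => [xy | /(congr1 val)/setP/(_ y)]; last first.
  by rewrite !inE connect0.
by apply/val_inj/setP=> z; rewrite !inE; apply: (same_connect (fconnect_sym face_inj) xy).
Qed.

Lemma region_of_face x : region_of (face x) = region_of x.
Proof. by apply/esym/region_ofP/fconnect1. Qed.

Lemma region_of_arc x : region_of (arc x) = region_of (prev_node x).
Proof. by rewrite -[RHS]region_of_face /face prev_nodeK. Qed.

Lemma region_of_surj (r : region P) : exists x, r = region_of x.
Proof. by case: r => r rP; case/existsP: (rP) => x /eqP rx; exists x; apply: val_inj. Qed.

Section State.
Variable sigma : state P.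

Lemma merged_node x : merged sigma (node x) = ~~ merged sigma x.
Proof. by rewrite /merged over_node /=; case: ifP. Qed.

Lemma merged_prev x : merged sigma (prev_node x) = ~~ merged sigma x.
Proof. by rewrite -{2}[x]prev_nodeK merged_node negbK. Qed.

(** The half-edge at the other end of the arc of the smoothing that starts at [x].
    State circles are traced by applying [arc] and [cut] alternately. *)
Definition cut x := if merged sigma x then prev_node x else node x.

Lemma cutK : involutive cut.
Proof.
move=> x; rewrite /cut; case mx: (merged sigma x).
  by rewrite merged_prev mx prev_nodeK.
by rewrite merged_node mx nodeK.
Qed.

Lemma cut_opposite x : cut (opposite x) = opposite (cut x).
Proof.
rewrite /cut !merged_node negbK; case: ifP => // _.
by rewrite !prev_nodeE.
Qed.

Lemma linkedE x y : linked sigma x y = (y == arc x) || (y == cut x).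
Proof.
rewrite /linked /cut; congr (_ || _).
have -> : (x == node y) = (y == prev_node x).
  by rewrite -{1}[x]prev_nodeK (can_eq nodeK) eq_sym.
have [-> | /negPf ne_y] := eqVneq y (prev_node x); last first.
  by case: ifP; rewrite ?ne_y ?orbF ?andbT ?andbF.
rewrite merged_prev negbK.
by case: (merged _ _); rewrite ?eqxx ?orbT ?andbT ?orbF ?andbF.
Qed.

Lemma linkedC : symmetric (connect (linked sigma)).
Proof.
apply: sym_connect_sym => x y; rewrite !linkedE.
by rewrite -(inv_eq (@arcK P)) -(inv_eq cutK) ![x == _]eq_sym.
Qed.

Lemma circle_ofP x y :
  reflect (circle_of sigma x = circle_of sigma y) (connect (linked sigma) x y).
Proof.
apply: (iffP idP) => [xy | /(congr1 val)/setP/(_ y)]; last first.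
  by rewrite !inE connect0.
by apply/val_inj/setP=> z; rewrite !inE; apply: (same_connect linkedC xy).
Qed.

Lemma linked_arc x : connect (linked sigma) x (arc x).
Proof. by apply: connect1; rewrite linkedE eqxx. Qed.

Lemma linked_cut x : connect (linked sigma) x (cut x).
Proof. by apply: connect1; rewrite linkedE eqxx orbT. Qed.

(** Adequacy speaks of the half-edges [(c, 0)] and [(c, 2)] only; the arcs of the
    smoothing carry the statement to the two others. *)
Lemma adequate_opposite x : adequate sigma ->
  ~~ connect (linked sigma) x (opposite x).
Proof.
move/forallP/(_ x.1)/negP=> adx; apply/negP=> xox; case: adx.
apply/eqP/circle_ofP; set h := (x.1, 0).
rewrite (_ : (x.1, 2%:R) = opposite h); last first.
  by congr pair; apply: val_inj.
have cutcut y : connect (linked sigma) y (opposite y) ->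
    connect (linked sigma) (cut y) (opposite (cut y)).
  move=> yoy; rewrite -cut_opposite; apply: connect_trans (linked_cut _).
  by apply: connect_trans yoy; rewrite linkedC linked_cut.
have opp y : connect (linked sigma) (opposite y) (opposite (opposite y)) ->
    connect (linked sigma) y (opposite y) by rewrite oppositeK linkedC.
have cut_node y : cut (node y) = y \/ cut (node y) = opposite y.
  by rewrite /cut; case: ifP => _; rewrite ?nodeK; [left | right].
case: (crossing_cases x) xox => /= [->|->|->|->] //; rewrite -/h.
- by move/cutcut; case: (cut_node h) => -> // /opp.
- exact: opp.
- by move/cutcut; case: (cut_node (opposite h)) => ->; rewrite oppositeK // linkedC.
Qed.

End State.

End HalfEdges.

(** * Checkerboard colorings and the Tait graph *)

Section Coloring.
Import GRing.Theory.
Local Open Scope ring_scope.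
Variables (P : pd_code) (K : coloring P).
Implicit Types (x y : half_edge P) (c d : crossing P) (sigma : state P).

Definition dark x := black K (region_of x).

Lemma dark_node x : dark (node x) = ~~ dark x.
Proof. exact: black_node. Qed.

Lemma dark_opposite x : dark (opposite x) = dark x.
Proof. by rewrite !dark_node negbK. Qed.

Lemma dark_prev x : dark (prev_node x) = ~~ dark x.
Proof. by rewrite -{2}[x]prev_nodeK dark_node negbK. Qed.

Lemma dark_arc x : dark (arc x) = ~~ dark x.
Proof. by rewrite -dark_prev /dark region_of_arc. Qed.

(** A half-edge separates two corners of its crossing, and exactly one of them is
    black. *)
Definition dark_corner x := if dark x then x else prev_node x.

Lemma dark_cornerP x : black K (region_of (dark_corner x)).
Proof.
by rewrite -/(dark _) /dark_corner; case: ifPn => // lx; rewrite dark_prev.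
Qed.

(** The black region along which the half-edge [x] runs: a vertex of the Tait graph
    that stays the same along an edge of the diagram, by [shore_arc], and changes
    along an arc of a smoothing only by crossing an edge of the Tait graph, by
    [shore_cut]. *)
Definition shore x : vertex (tait_graph K) :=
  exist (fun r => black K r) _ (dark_cornerP x).

Lemma shore_arc x : shore (arc x) = shore x.
Proof.
apply: val_inj; rewrite /= /dark_corner dark_arc.
case: (dark x) => /=; last exact: region_of_arc.
by rewrite -region_of_arc arcK.
Qed.

Lemma shore_prev x :
  shore (prev_node x) = if dark x then shore (opposite x) else shore x.
Proof.
case: ifP => dx; apply: val_inj; rewrite /= /dark_corner dark_prev ?dark_opposite dx //=.
by rewrite !prev_nodeE /opposite node4.
Qed.

Lemma shore_node x :
  shore (node x) = if dark x then shore x else shore (opposite x).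
Proof.
have := shore_prev (opposite x); rewrite prev_nodeE dark_opposite oppositeK.
rewrite -[opposite (node _)]/(opposite (opposite (node x))) oppositeK => ->.
by [].
Qed.

Lemma shore_surj (r : vertex (tait_graph K)) : exists x, shore x = r.
Proof.
case: r => r br; have [x rx] := region_of_surj r; exists x.
by apply: val_inj; rewrite /= /dark_corner /dark -rx br.
Qed.

Lemma ends_tait c : ends (c : edge (tait_graph K)) =
  (shore (black_corner K c), shore (opposite (black_corner K c))).
Proof.
have dc : dark (black_corner K c) by apply: black_cornerP.
by congr pair; apply: val_inj; rewrite /= /dark_corner ?dark_opposite dc.
Qed.

Lemma crossing_black_corner c : (black_corner K c).1 = c.
Proof. by rewrite /black_corner; case: ifP. Qed.

Lemma black_corner_cases x : dark x ->
  x = black_corner K x.1 \/ x = opposite (black_corner K x.1).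
Proof.
have := crossing_cases x; rewrite /black_corner -/(dark _).
set h := (x.1, 0); case: ifP => dh /= [] -> ; rewrite ?dark_node ?dh //=; auto.
Qed.

Lemma joins_shore x :
  @joins (tait_graph K) x.1 (shore x) (shore (opposite x)).
Proof.
have dark_case y : dark y -> @joins (tait_graph K) y.1 (shore y) (shore (opposite y)).
  rewrite /joins ends_tait => /black_corner_cases[/esym-> | yE].
    by rewrite eqxx.
  have -> : black_corner K y.1 = opposite y by rewrite {2}yE oppositeK.
  by rewrite oppositeK eqxx orbT.
have [/dark_case// | lx] := boolP (dark x).
have := dark_case (node x); rewrite dark_node lx => /(_ isT).
rewrite shore_node (negPf lx).
rewrite [opposite (node x)]/(node (opposite x)) (shore_node (opposite x)).
rewrite dark_opposite (negPf lx).
by rewrite oppositeK joinsC.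
Qed.

(** The edges of the Tait graph along which the smoothing joins the two black
    regions, as a band does when the black surface is built from disks and bands. *)
Definition band_set sigma : {set edge (tait_graph K)} :=
  [set c | merged sigma (black_corner K c)].

Lemma mergedE sigma x : merged sigma x = (dark x == (x.1 \in band_set sigma)).
Proof.
have dark_case y : dark y -> merged sigma y = (y.1 \in band_set sigma).
  rewrite inE => /black_corner_cases[/esym-> // | yE].
  by rewrite {1}yE !merged_node negbK.
have [/dark_case-> // | lx] := boolP (dark x).
have := dark_case (node x); rewrite dark_node lx merged_node => /(_ isT) /= <-.
by case: (merged _ _).
Qed.

Lemma band_set_inj : injective band_set.
Proof.
move=> s1 s2 eq_s; apply/ffunP=> c.
have := mergedE s1 (c, 0); rewrite eq_s -mergedE /merged /=.
by rewrite /resA; case: (s1 c); case: (s2 c).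
Qed.

Lemma dark_cut sigma x : dark (cut sigma x) = ~~ dark x.
Proof. by rewrite /cut; case: ifP; rewrite ?dark_node ?dark_prev. Qed.

Lemma shore_cut sigma x : shore (cut sigma x) =
  if x.1 \in band_set sigma then shore (opposite x) else shore x.
Proof.
by rewrite /cut mergedE; case: (dark x) (shore_node x) (shore_prev x) => /=;
  case: (_ \in _).
Qed.

Section Walk.
Variable sigma : state P.
Hypothesis sigma_adequate : adequate sigma.

(** Two consecutive steps along a state circle.  Both [arc] and [cut] exchange the
    half-edges whose next corner counterclockwise is black with those for which it is
    white, so [walk] keeps to one kind and goes around the circle in one direction. *)
Definition walk x := cut sigma (arc x).

Lemma walk_inj : injective walk.
Proof. exact: inj_comp (can_inj (cutK sigma)) (can_inj (@arcK P)). Qed.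

Lemma linked_walk n x : connect (linked sigma) x (iter n walk x).
Proof.
elim: n => // n IHn; apply: connect_trans IHn _.
exact: connect_trans (linked_arc _ _) (linked_cut _ _).
Qed.

Lemma dark_walk n x : dark (iter n walk x) = dark x.
Proof. by elim: n => //= n <-; rewrite dark_cut dark_arc negbK. Qed.

(** The state circle that leaves [e] along one side of its band comes back to [e],
    and the black regions that it follows form a walk between the ends of [e].
    That walk uses the band of [e] only if the circle passes along its other side,
    or along the same side before its return; adequacy excludes the former, and the
    coloring, which orients the circle, together with the choice of the first
    return excludes the latter. *)
Lemma band_not_bridge e : e \in band_set sigma ->
  e \in graphic_matroid (tait_graph K) (band_set sigma :\ e).
Proof.
move=> eT; rewrite [_ \in _]mem_graph_cl ends_tait /=.
set x := black_corner K e.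
have xe : x.1 = e := crossing_black_corner e.
have dx : dark x := black_cornerP K e.
have mx : merged sigma x by rewrite mergedE xe dx eT.
have cutx : cut sigma x = prev_node x by rewrite /cut mx.
have [n [walk_n walk_lt]] : exists n, iter n.+1 walk x = x /\
    forall i, (0 < i <= n)%N -> iter i walk x != x.
  exists (order walk x).-1; rewrite prednK ?order_gt0 //; split.
    exact: iter_order walk_inj _.
  move=> i /andP[i_gt0]; rewrite -ltnS prednK ?order_gt0 // => lt_i.
  apply: contraTneq i_gt0 => wi; rewrite -leqNgt leqn0.
  by rewrite -(findex_iter lt_i) wi findex0.
have step_n i : (i <= n)%N ->
    linked_in (band_set sigma :\ e) (shore x) (shore (iter i walk x)).
  elim: i => [|i IHi] lt_in; first exact: connect0.
  apply: linked_in_trans (IHi (ltnW lt_in)) _.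
  set y := arc (iter i walk x); rewrite -shore_arc -/y iterS -/y /walk -/y.
  rewrite shore_cut; case: ifP => yT; last exact: connect0.
  apply: linked_in1 (joins_shore y).
  rewrite in_setD1 yT andbT; apply/eqP=> ye.
  have xy : connect (linked sigma) x y.
    by apply: connect_trans (linked_walk i x) (linked_arc _ _).
  have ly : ~~ dark y by rewrite dark_arc dark_walk dx.
  have nox := adequate_opposite x sigma_adequate.
  have [y_prev | y_node] : y = prev_node x \/ y = node x.
    have := @black_corner_cases (node y); rewrite dark_node ly /= ye -/x.
    case=> // /(canRL (@nodeK P)) ->; [by left | right].
    by rewrite prev_nodeE -[RHS]oppositeK.
  - case/negP: (walk_lt i.+1 lt_in).
    by rewrite iterS /walk -/y y_prev -cutx cutK.
  case/negP: nox; apply: connect_trans xy _.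
  by rewrite y_node; have := linked_cut sigma (node x); rewrite /cut merged_node mx.
(* the circle returns to [x] by the arc of the smoothing that ends there *)
have wn : arc (iter n walk x) = prev_node x.
  by apply: (can_inj (cutK sigma)); rewrite -cutx cutK.
have := step_n n (leqnn n); rewrite -(shore_arc (iter n walk x)) wn shore_prev dx.
by [].
Qed.

End Walk.
End Coloring.

(** * The two checkerboard graphs are dual *)

Section CheckerboardDuality.
Import GRing.Theory.
Local Open Scope ring_scope.

Lemma sum_half_edges (V : nmodType) (P : pd_code) (F : half_edge P -> V) :
  \sum_x F x = \sum_(c : crossing P) let h := (c, 0) in
    (F h + F (node h) + (F (opposite h) + F (node (opposite h)))).
Proof.
transitivity (\sum_(c : crossing P) \sum_(k < 4) F (c, k)).
  by rewrite pair_bigA /=; apply: eq_bigr => -[].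
apply: eq_bigr => c _ /=.
have E k (x : half_edge P) : (c, k) = x -> F (c, k) = F x by move->.
rewrite !big_ord_recl big_ord0 addr0 -addrA.
by congr (_ + (_ + (_ + _))); apply: E; congr pair; apply: val_inj.
Qed.

Section Opposite.
Variables (P : pd_code) (K : coloring P).

Definition white_coloring : coloring P :=
  @Coloring P (fun r => ~~ black K r)
    (fun x => congr1 negb (black_node K x)).

Lemma dark_white x : dark white_coloring x = ~~ dark K x.
Proof. by []. Qed.

Lemma band_set_white sigma : band_set white_coloring sigma = ~: band_set K sigma.
Proof.
apply/setP=> c; have := mergedE white_coloring sigma (c, 0).
rewrite (mergedE K) dark_white in_setC /=.
by case: (dark K _); do 2!case: (c \in _).
Qed.

Lemma card_faces : #|region P| =
  (#|vertex (tait_graph K)| + #|vertex (tait_graph white_coloring)|)%N.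
Proof.
rewrite -(cardC [pred r | black K r]).
by congr (_ + _)%N; rewrite [RHS]card_sig; apply: eq_card => r; rewrite !inE.
Qed.

(** A half-edge runs along one black and one white region, and the entry for two such
    regions counts the half-edges that run along both; these come in pairs
    exchanged by [arc]. *)
Lemma incidence_ortho :
  incidence (tait_graph K) *m (incidence (tait_graph white_coloring))^T = 0.
Proof.
apply/matrixP=> i j; rewrite !mxE; set v := enum_val i; set w := enum_val j.
pose F x : 'F_2 := (v == shore K x)%:R * (w == shore white_coloring x)%:R.
transitivity (\sum_x F x).
  rewrite sum_half_edges (reindex (@enum_rank _)) /=; last first.
    by exists enum_val => k _; rewrite ?enum_rankK ?enum_valK.
  apply: eq_bigr => c _; rewrite !mxE enum_rankK -/v -/w.
  pose h : half_edge P := (c, 0); rewrite !(incident_joins _ (joins_shore _ h)) /F.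
  rewrite -/h !(shore_node _ h) !(shore_node _ (opposite h)) !dark_opposite.
  rewrite !oppositeK dark_white.
  have expand (a b p q : 'F_2) :
    (a + b) * (p + q) = a * p + a * q + (b * q + b * p).
    by rewrite mulrDl !mulrDr [b * p + _]addrC.
  have expand' (a b p q : 'F_2) :
    (a + b) * (p + q) = a * p + b * p + (b * q + a * q).
    by rewrite mulrDl !mulrDr [b * q + _]addrC addrACA.
  by case: (dark K h); [apply: expand | apply: expand'].
have F_arc x : F (arc x) = F x by rewrite /F !shore_arc.
rewrite (bigID (dark K)) /= [X in _ + X](reindex_inj (can_inj (@arcK P))) /=.
under [X in _ + X]eq_big => [x|x _] do [rewrite dark_arc negbK | rewrite F_arc].
exact: addrr_F2.
Qed.

Hypothesis P_connected : connected P.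

Lemma tait_connected : connected_by [set: edge (tait_graph K)].
Proof.
pose L x y := @linked_in (tait_graph K) setT (shore K x) (shore K y).
have Ltrans x y z : L x y -> L y z -> L x z by apply: linked_in_trans.
have LC x y : L x y = L y x by apply: linked_inC.
have Lopp x : L x (opposite x) by apply: linked_in1 (joins_shore K x).
have Lnode x : L x (node x).
  by rewrite /L shore_node; case: ifP => _; [apply: connect0 | apply: Lopp].
have L0 x : L (x.1, 0) x.
  have := crossing_cases x; set h := (x.1, 0) => -[]->; rewrite ?Lopp //.
    exact: connect0.
  exact: Ltrans (Lopp h) (Lnode _).
have Lconn c d : L (c, 0) (d, 0).
  have /connectP[p + ->] := P_connected c d.
  elim: p c => [|c' p IHp] c /=; first by move=> _; apply: connect0.
  case/andP=> /existsP[i /eqP ci] /IHp; apply: (Ltrans).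
  apply: Ltrans (L0 (c, i)) _; rewrite /L -shore_arc -/(L _ _) LC -ci; apply: L0.
apply/forallP=> u; apply/forallP=> v.
have [x <-] := shore_surj u; have [y <-] := shore_surj v.
apply: Ltrans (Ltrans _ _ _ (Lconn x.1 y.1) (L0 y)).
by rewrite LC L0.
Qed.

Hypothesis P_crossing : (0 < #|crossing P|)%N.
Hypothesis P_planar : planar P.

Lemma fcard_arc : fcard (@arc P) {: half_edge P} = (2 * #|crossing P|)%N.
Proof.
have arc_inj := can_inj (@arcK P).
have order2 x : order (@arc P) x = 2%N.
  rewrite /order.
  transitivity #|pred2 x (arc x)|; last by rewrite card2 eq_sym arc_neq.
  apply: eq_card => y; rewrite !inE; apply/idP/orP=> [/iter_findex <- | []/eqP->].
  - elim: (findex _ _ _) => [|n IHn] /=; first by left.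
    by case: IHn => /eqP->; rewrite ?arcK eqxx; [right | left].
  - exact: connect0.
  exact: fconnect1.
have /(_ 2%N {: half_edge P}) := fcard_order_set arc_inj.
rewrite card_prod card_ord => fcard2.
apply/eqP; rewrite -(eqn_pmul2r (isT : 0 < 2)%N) fcard2 //.
  by rewrite mulnC mulnAC.
by apply/subsetP=> x _; rewrite inE order2.
Qed.

Lemma n_comp1 : n_comp (@adjacent P) {: crossing P} = 1%N.
Proof.
have [c _] := card_gt0P P_crossing.
have symP : connect_sym (@adjacent P) by move=> d d'; rewrite !P_connected.
rewrite -(n_comp_connect symP c); apply: eq_n_comp_r => d.
by rewrite !inE [RHS]P_connected.
Qed.

(** Black and white regions together are the faces, and a 4-valent graph has twice
    as many edges as vertices. *)
Lemma euler_tait :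
  (#|vertex (tait_graph K)| + #|vertex (tait_graph white_coloring)|
   = #|crossing P| + 2)%N.
Proof.
have := P_planar; rewrite /planar -card_faces fcard_arc n_comp1; lia.
Qed.

End Opposite.

End CheckerboardDuality.

(** * Adequate states *)

Section Adequate.
Import GRing.Theory.
Local Open Scope ring_scope.
Variables (P : pd_code) (K : coloring P).
Hypothesis P_connected : connected P.
Hypothesis P_crossing : (0 < #|crossing P|)%N.
Hypothesis P_planar : planar P.

(** No edge of [band_set] is a bridge, by [band_not_bridge].  The same fact for the
    white regions says that the white ends of an edge [e] outside the set are joined
    by other white bands, so by duality its black ends are not joined inside the
    set. *)
Lemma band_set_cyclic_flat sigma : adequate sigma ->
  cyclic_flat (graphic_matroid (tait_graph K)) (band_set K sigma).
Proof.
move=> ad; set T := band_set K sigma.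
apply/andP; split; last by apply/forall_inP=> e; apply: band_not_bridge.
rewrite eqEsubset sub_cl andbT; apply/subsetP=> e; rewrite [_ \in _]mem_graph_cl => Te.
apply: contraT => eT; exfalso.
have eT' : e \in band_set (white_coloring K) sigma by rewrite band_set_white in_setC.
have := band_not_bridge ad eT'; rewrite [_ \in _]mem_graph_cl => T'e.
refine (no_linked_in_dual _ _ (incidence_ortho K) _ eT _ _ Te T'e).
- exact: tait_connected.
- exact: tait_connected.
- exact: euler_tait.
- by rewrite in_setD1 eqxx.
- rewrite disjoint_sym disjoints_subset /T -band_set_white; exact: subD1set.
Qed.

Lemma card_adequate_le :
  (#|adequate_states P| <= #|spanning_trees (tait_graph K)|)%N.
Proof.
rewrite -(card_imset _ (@band_set_inj P K)).
have flats_le := card_cyclic_flats_le (graphic_matroid (tait_graph K)).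
apply: leq_trans (subset_leq_card _) (leq_trans flats_le (subset_leq_card _)).
  apply/subsetP=> _ /imsetP[s sad ->]; rewrite inE band_set_cyclic_flat //.
  by rewrite inE in sad.
by apply/subsetP=> B; rewrite !inE; apply/basis_spanning_tree/tait_connected.
Qed.

(** The state that cuts off all the black corners of [K']; its circles are the
    boundaries of the black regions. *)
Definition split_state (K' : coloring P) : state P := [ffun c => dark K' (c, 0)].

Lemma merged_split_state K' x : merged (split_state K') x = ~~ dark K' x.
Proof.
have m0 : merged (split_state K') (x.1, 0) = ~~ dark K' (x.1, 0).
  by rewrite /merged ffunE; case: (dark _ _).
have:= crossing_cases x; case=> ->;
by rewrite ?(merged_node, dark_node) ?m0.
Qed.

(** The black region along which a state circle runs never changes, whereas the two
    circles at a crossing run along the two black regions there, which are distinct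
    in a reduced diagram. *)
Lemma split_state_adequate K' : reduced P -> adequate (split_state K').
Proof.
move=> red; apply/forallP=> c; set s := split_state K'.
have no_band (x : half_edge P) : x.1 \in band_set K' s = false.
  have := mergedE K' s x; rewrite merged_split_state.
  by case: (dark _ _) (_ \in _) => -[].
have shore_linked x y : connect (linked s) x y -> shore K' x = shore K' y.
  case/connectP=> p + ->; elim: p x => //= z p IHp x.
  case/andP=> + /IHp<-; rewrite linkedE => /orP[] /eqP->.
    by rewrite shore_arc.
  by rewrite shore_cut no_band.
apply/negP=> /eqP/circle_ofP/shore_linked/(congr1 val) /=.
have -> : (c, 2%:R) = opposite (c, 0) :> half_edge P.
  by congr pair; apply: val_inj.
have reg_inj := injectiveP _ (negbNE (red c)).
rewrite /dark_corner dark_opposite.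
by case: ifP => _ /reg_inj/(congr1 val).
Qed.

Lemma two_le_card_adequate : reduced P -> (2 <= #|adequate_states P|)%N.
Proof.
move=> red; have [c _] := card_gt0P P_crossing.
pose s1 := split_state K; pose s2 := split_state (white_coloring K).
have ne12 : s1 != s2.
  by apply/eqP=> /ffunP/(_ c); rewrite !ffunE dark_white; case: (dark _ _).
have <- : #|[set s1; s2]| = 2%N by rewrite cards2 ne12.
apply/subset_leq_card/subsetP=> s; rewrite !inE.
by case/orP=> /eqP->; apply: split_state_adequate.
Qed.
End Adequate.

Theorem theorem1p4 (D : diagram) (K : coloring D)
    (D_crossing : 0 < #|crossing D|)
    (D_connected : connected D)
    (D_reduced : reduced D) :
  2 <= #|adequate_states D| /\
  #|adequate_states D| <= #|spanning_trees (tait_graph K)|.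
Proof.
split; first exact: two_le_card_adequate.
exact: card_adequate_le (diagram_planar D).
Qed.
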